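(* Let $a<b$ and let $f,g:[0,1]\to[a,b]$ be step functions, and let $r=D_1^{\updownarrow}(f,g)$, assumed to lie in $(0,b-a]$. Then \[r\le L_1(\hat f,\hat g)\le\left(2-\frac{r}{b-a}\right)\cdot r.\] Moreover the bound is tight: for every $r\in(0,b-a]$ there exist step functions $f_0,g_0:[0,1]\to[a,b]$ with $D_1^{\updownarrow}(f_0,g_0)=r$ and $L_1(\hat f_0,\hat g_0)=\left(2-\frac{r}{b-a}\right)\cdot r$.
   Context: A step function on $[0,1]$ is a function for which $[0,1]$ can be split into finitely many intervals on each of which it is constant. $L_1(f,g)=\int_0^1|f(x)-g(x)|\,dx$ and $D_1^{\updownarrow}(f,g)=\min_{\alpha\in\mathbb{R}}\int_0^1|f(x)+\alpha-g(x)|\,dx$. For $\phi:[0,1]\to\mathbb{R}$, $\bar\phi=\int_0^1\phi(x)\,dx$ and the mean-reduction is $\hat\phi(x)=\phi(x)-\bar\phi$. *)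

(* Defs.v *)
From HB Require Import structures.
From mathcomp Require Import all_boot all_order all_algebra.
From mathcomp Require Import all_classical all_reals all_analysis.
From mathcomp Require Import ring lra.

Set Implicit Arguments.
Unset Strict Implicit.
Unset Printing Implicit Defensive.

Import Order.TTheory GRing.Theory Num.Theory.
Import numFieldNormedType.Exports.

Local Open Scope classical_set_scope.
Local Open Scope ring_scope.

(* A function on [0,1] is represented by a function R -> R; nothing below
   depends on its values outside [0,1]. *)

(* The intervals I k may be open, closed, half-open or single points. *)
Definition step_function (R : realType) (f : R -> R) : Prop :=
  exists (n : nat) (I : 'I_n -> interval R),
    [/\ trivIset setT (fun k => [set` I k]),
        \bigcup_k [set` I k] = `[0, 1]%classic
      & forall k, exists c, forall x, x \in I k -> f x = c].

Definition L1 (R : realType) (f g : R -> R) : R :=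
  \int[lebesgue_measure]_(x in `[0, 1]%classic) `|f x - g x|.

(* For step functions the infimum is attained: see D1_attained below. *)
Definition D1 (R : realType) (f g : R -> R) : R :=
  inf (range (fun alpha : R => L1 (fun x => f x + alpha) g)).

Definition mean (R : realType) (phi : R -> R) : R :=
  \int[lebesgue_measure]_(x in `[0, 1]%classic) phi x.

Definition mean_reduction (R : realType) (phi : R -> R) : R -> R :=
  fun x => phi x - mean phi.

Lemma step_function_integrable (R : realType) (f : R -> R) :
  step_function f ->
  lebesgue_measure.-integrable `[0, 1]%classic (EFin \o f).
Proof.
move=> [n [I [_ UI cI]]]; have [c cE] := choice cI.
apply: measurable_bounded_integrable => //.
- by rewrite /= lebesgue_measure_itv/= lte01 oppr0 adde0 ltry.
- rewrite -UI => _ Y mY.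
  rewrite setI_bigcupl; apply: fin_bigcup_measurable => // k _.
  have : measurable_fun [set` I k] f.
    apply: (eq_measurable_fun (cst (c k))); last exact: measurable_cst.
    by move=> x; rewrite inE => /cE.
  by apply.
- exists (\sum_k `|c k|); split; first by rewrite num_real.
  move=> M cM x; rewrite -UI => -[k _ /= /cE ->].
  apply: le_trans (ltW cM).
  by rewrite (bigD1 k)//= lerDl sumr_ge0.
Qed.

Lemma D1_attained (R : realType) (f g : R -> R) :
  step_function f -> step_function g ->
  exists2 alpha : R, D1 f g = L1 (fun x => f x + alpha) g &
    forall beta : R,
      L1 (fun x => f x + alpha) g <= L1 (fun x => f x + beta) g.
Proof.
move=> /step_function_integrable fi /step_function_integrable gi.
pose F (t : R) := L1 (fun x => f x + t) g.
have mu1 : lebesgue_measure (`[0, 1]%classic : set R) = 1%:E.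
  by rewrite /= lebesgue_measure_itv/= lte01 oppr0 adde0.
have ci (t : R) :
    lebesgue_measure.-integrable `[0, 1]%classic (EFin \o cst t : R -> \bar R).
  apply: measurable_bounded_integrable => //.
  + by rewrite [X in (X < _)%E]mu1 ltry.
  + by exists `|t|; split => [|M tM x _ /=]; [rewrite num_real|exact: ltW].
have Fi (t : R) : lebesgue_measure.-integrable `[0, 1]%classic
    (EFin \o (fun x => `|f x + t - g x|)).
  have /integrable_abse : lebesgue_measure.-integrable `[0, 1]%classic
      (EFin \o (fun x => f x + t - g x)).
    exact: (integrableB _ (integrableD _ fi (ci t)) gi).
  by apply: eq_integrable => // x _ /=.
have intc (t : R) : \int[lebesgue_measure]_(x in `[0, 1]%classic) cst t x = t.
  by rewrite Rintegral_cst// [X in fine X]mu1 /= mulr1.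
have FS (s t u : R) : (forall y : R, `|y + s| <= `|y + t| + u) -> F s <= F t + u.
  move=> h; rewrite /F /L1 -[X in _ <= _ + X](intc u) -RintegralD//.
  apply: le_Rintegral => //.
    exact: (integrableD _ (Fi t) (ci u)).
  move=> x _ /=; have := h (f x - g x).
  by rewrite addrAC (addrAC _ _ t).
have FC (t : R) : `|t| <= F t + F 0.
  rewrite -[X in X <= _](intc `|t|) /F /L1 -RintegralD//.
  apply: le_Rintegral => //.
    exact: (integrableD _ (Fi t) (Fi 0)).
  move=> x _ /=.
  have -> : t = (f x + t - g x) - (f x + 0 - g x) by ring.
  have -> : f x + (f x + t - g x - (f x + 0 - g x)) - g x = f x + t - g x by ring.
  exact: ler_normB.
have F0 : 0 <= F 0 by apply: Rintegral_ge0.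
have Fcont : continuous F.
  move=> s; apply/cvgrPdist_le => e e0; near=> t.
  have st : `|s - t| <= e.
    by near: t; apply: (@cvgr_dist_le _ _ _ _ _ id s) => //; exact: cvg_id.
  have h1 : F s <= F t + `|s - t|.
    apply: FS => y; have -> : y + s = (y + t) + (s - t) by ring.
    exact: ler_normD.
  have h2 : F t <= F s + `|s - t|.
    apply: FS => y; have -> : y + t = (y + s) - (s - t) by ring.
    exact: ler_normB.
  by rewrite ler_norml; apply/andP; split; lra.
have [|c _ cmin] := @EVT_min R F (- (2 * F 0)) (2 * F 0) _ (continuous_subspaceT Fcont).
  lra.
have cle t : F c <= F t.
  have [tF|Ft] := leP `|t| (2 * F 0).
    by apply: cmin; rewrite in_itv /= -ler_norml.
  have c0 : F c <= F 0 by apply: cmin; rewrite in_itv/=; apply/andP; split; lra.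
  have := FC t; lra.
exists c => //; apply/eqP; rewrite eq_le; apply/andP; split.
- apply: ge_inf; last by exists c.
  by exists (F c) => _ [t _ <-]; exact: cle.
- apply: lb_le_inf; first by exists (F c); exists c.
  by move=> _ [t _ <-]; exact: cle.
Unshelve. all: by end_near. Qed.

(* Main.v *)
(* Put h = f - g, d = b - a, so that |h| <= d; then D1 f g = r = E|h - c| for a
   minimiser c and L1 of the mean-reductions is E|h - m| with m = E h.  The lower
   bound is minimality of c.  For the upper bound assume c <= m, replacing h by
   -h if needed.  By convexity (h - m)^+ <= q (h - c)^+ with
   q = (d - m) / (d - c), which integrates to E|h - m| <= q (r + m - c).
   Minimality of c against the translations d and -d gives r <= d - m and
   r <= d + m, and with m - c <= r these imply q (r + m - c) <= (2 - r / d) r.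
   Equality holds when h is d on a set of measure r / (2 d) and -d elsewhere. *)
Require Import Defs.
From mathcomp Require Import all_boot all_order all_algebra.
From mathcomp Require Import all_classical all_reals all_analysis.
From mathcomp Require Import ring lra.

Import Order.TTheory GRing.Theory Num.Theory.

Local Open Scope classical_set_scope.
Local Open Scope ring_scope.

Local Notation integrable01 h :=
  (lebesgue_measure.-integrable `[0, 1]%classic (EFin \o h)).

Lemma lebesgue_measure01 (R : realType) :
  lebesgue_measure (`[0, 1]%classic : set R) = 1%:E.
Proof. by rewrite /= lebesgue_measure_itv/= lte01 oppr0 adde0. Qed.

Lemma integrable01_cst (R : realType) (k : R) : integrable01 (fun _ : R => k).
Proof.
apply: measurable_bounded_integrable => //.
- by rewrite [X in (X < _)%E]lebesgue_measure01 ltry.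
- by exists `|k|; split => [|M kM x _ /=]; [rewrite num_real|exact: ltW].
Qed.

Section mean.
Context (R : realType).
Implicit Types (h k : R -> R) (c : R).

Lemma integrable01D h k :
  integrable01 h -> integrable01 k -> integrable01 (fun x => h x + k x).
Proof. by move=> hi ki; exact: (integrableD _ hi ki). Qed.

Lemma integrable01B h k :
  integrable01 h -> integrable01 k -> integrable01 (fun x => h x - k x).
Proof. by move=> hi ki; exact: (integrableB _ hi ki). Qed.

Lemma integrable01Z c h : integrable01 h -> integrable01 (fun x => c * h x).
Proof. by move=> hi; exact: (integrableZl _ _ hi). Qed.

Lemma integrable01_norm h : integrable01 h -> integrable01 (fun x => `|h x|).
Proof. by move=> /integrable_abse; apply: eq_integrable. Qed.

Ltac int01 := repeat first [ assumption | exact: integrable01_cst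
  | apply: integrable01_norm | apply: integrable01Z
  | apply: integrable01B | apply: integrable01D ].

Lemma mean_cst c : mean (fun _ : R => c) = c.
Proof. by rewrite /mean Rintegral_cst// [X in fine X]lebesgue_measure01 mulr1. Qed.

Lemma meanD h k : integrable01 h -> integrable01 k ->
  mean (fun x => h x + k x) = mean h + mean k.
Proof. by move=> hi ki; rewrite /mean RintegralD. Qed.

Lemma meanB h k : integrable01 h -> integrable01 k ->
  mean (fun x => h x - k x) = mean h - mean k.
Proof. by move=> hi ki; rewrite /mean RintegralB. Qed.

Lemma meanZ c h : integrable01 h -> mean (fun x => c * h x) = c * mean h.
Proof. by move=> hi; rewrite /mean RintegralZl. Qed.

Lemma le_mean h k : integrable01 h -> integrable01 k ->
  (forall x, x \in `[0, 1] -> h x <= k x) -> mean h <= mean k.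
Proof. by move=> hi ki hk; exact: le_Rintegral. Qed.

Lemma eq_mean h k : (forall x, x \in `[0, 1] -> h x = k x) -> mean h = mean k.
Proof. by move=> hk; apply: eq_Rintegral => x; rewrite inE => /hk. Qed.

(** This carries the whole upper bound. The one-sided hypothesis [c <= mean h] is a normalisation:
    replacing h, c by -h, -c reverses it, so either f - g or g - f can serve as h. *)
Lemma mean_deviation_le h d c :
    integrable01 h -> (forall x, x \in `[0, 1] -> `|h x| <= d) ->
    c <= mean h ->
    (forall t, mean (fun x => `|h x - c|) <= mean (fun x => `|h x - t|)) ->
    0 < mean (fun x => `|h x - c|) ->
  mean (fun x => `|h x - mean h|) <=
    (2 - mean (fun x => `|h x - c|) / d) * mean (fun x => `|h x - c|).
Proof.
set r := mean (fun x => `|h x - c|); set m := mean h.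
move=> hi hd cm rmin r0.
have ci := @integrable01_cst R.
have absi t : integrable01 (fun x => `|h x - t|).
  exact/integrable01_norm/integrable01B.
have hbd x : x \in `[0, 1] -> - d <= h x <= d by rewrite -ler_norml; exact: hd.
have hB t : mean (fun x => h x - t) = m - t by rewrite meanB// mean_cst.
have r_le_dBm : r <= d - m.
  apply: le_trans (rmin d) _.
  rewrite -[leRHS](_ : mean (fun x => d - h x) = _); last first.
    by rewrite meanB// mean_cst.
  apply: le_mean => //; first exact: integrable01B.
  by move=> x /hbd /andP[_ hxd]; rewrite ler0_norm; lra.
have r_le_dDm : r <= d + m.
  apply: le_trans (rmin (- d)) _.
  rewrite -[leRHS](_ : mean (fun x => d + h x) = _); last first.
    by rewrite meanD// mean_cst.
  apply: le_mean => //; first exact: integrable01D.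
  by move=> x /hbd /andP[hxd _]; rewrite ger0_norm; lra.
have s_le_r : m - c <= r.
  rewrite -hB.
  apply: le_mean => //; first exact: integrable01B.
  by move=> x _; exact: ler_norm.
pose q := (d - m) / (d - c).
(* d - c >= d - m >= r > 0, from [cm], [r_le_dBm] and [r0]. *)
have dc0 : 0 < d - c by lra.
have q0 : 0 <= q by rewrite divr_ge0; lra.
have q1 : q <= 1 by rewrite ler_pdivrMr//; lra.
have qE : q * (d - c) = d - m by rewrite /q divfK// gt_eqF.
have dev_le : mean (fun x => `|h x - m|) <= q * (r + (m - c)).
  (* The integrand is 2 q (h - c)^+ - (h - m), whose last term has mean zero. *)
  have -> : q * (r + (m - c)) =
      mean (fun x => q * (`|h x - c| + (h x - c)) - (h x - m)).
    rewrite meanB; [|by int01|by int01].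
    rewrite meanZ; last by int01.
    rewrite hB meanD; [|by int01|by int01].
    by rewrite hB -/r subrr subr0.
  apply: le_mean => //.
    by int01.
  (* |y - m| = 2 (y - m)^+ - (y - m), and likewise for c. *)
  move=> x /hbd /andP[_ hxd].
  have [xc|xc] := leP (h x) c.
    by rewrite !ler0_norm; [lra|lra|lra].
  rewrite (ger0_norm (x := h x - c)); last lra.
  have [xm|xm] := leP (h x) m.
    rewrite ler0_norm; last lra.
    have : 0 <= q * (h x - c) by apply: mulr_ge0; lra.
    lra.
  rewrite ger0_norm; last lra.
  (* By [qE] this product equals q (h x - c) - (h x - m). *)
  have : 0 <= (1 - q) * (d - h x) by apply: mulr_ge0; lra.
  nra.
apply: le_trans dev_le _.
(* Adding [r_le_dBm] and [r_le_dDm] gives r <= d. *)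
have d0 : 0 < d by lra.
rewrite /q -subr_ge0.
rewrite (_ : _ - _ = (((2 * d - r) * r * (d - c) - d * (d - m) * (r + (m - c)))) / (d * (d - c))); last first.
  by field; rewrite !gt_eqF.
apply: divr_ge0; last by apply: mulr_ge0; lra.
(* The numerator is affine in d - c for fixed m - c; interpolate between the
   extreme values r + (m - c) and 2 d - r + (m - c) of d - c. *)
rewrite (_ : _ - _ = ((d - m - r) * (2 * d - r) * (r - (m - c)) +
  (d + m - r) * r * (r + (m - c))) / 2); last by field.
by apply: divr_ge0 => //; apply: addr_ge0; apply: mulr_ge0; try apply: mulr_ge0; lra.
Qed.

End mean.

Section two_step.
Context (R : realType) (p : R) (p0 : 0 <= p) (p1 : p <= 1).

Let two_step (u v : R) : R -> R := fun x => if x <= p then u else v.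

Lemma step_function_two_step u v : step_function (two_step u v).
Proof.
exists 2, (fun k : 'I_2 => if k == ord0 then `[0, p] else `]p, 1]).
split.
- apply/trivIsetP => i j _ _ ij.
  apply/seteqP; split => // x [].
  case: i j ij => [[|[|//]] ?] [[|[|//]] ?] //= _.
  + rewrite !in_itv/=; lra.
  + rewrite !in_itv/=; lra.
- apply/seteqP; split => x.
    move=> [k _]; case: ifPn => _ /=; rewrite !in_itv/= => /andP[x0 x1].
      by rewrite x0 (le_trans x1).
    by rewrite x1 (le_trans p0) ?ltW.
  rewrite /= in_itv/= => /andP[x0 x1].
  have [xp|xp] := leP x p.
    by exists ord0 => //=; rewrite in_itv/= x0.
  by exists ord_max => //=; rewrite in_itv/= xp.
- move=> k; case: ifPn => _.
    by exists u => x; rewrite in_itv/= /two_step => /andP[_ ->].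
  by exists v => x; rewrite in_itv/= /two_step => /andP[px _]; rewrite leNgt px.
Qed.

Lemma mean_two_step u v : mean (two_step u v) = p * u + (1 - p) * v.
Proof.
have i01 := step_function_integrable (step_function_two_step u v).
have E : `[0, 1]%classic = `[0, p] `|` `]p, 1] :> set R.
  by rewrite -itv_bndbnd_setU// bnd_simp.
rewrite /mean E Rintegral_setU//=; last 2 first.
  by rewrite -E.
  apply/disj_setPS => x [] /=; rewrite !in_itv/=; lra.
congr +%R.
- transitivity (\int[lebesgue_measure]_(x in `[0, p]%classic) cst u x).
    by apply: eq_Rintegral => x; rewrite inE/= in_itv/= /two_step => /andP[_ ->].
  rewrite Rintegral_cst//= mulrC.
  congr (_ * _); rewrite lebesgue_measure_itv/= lte_fin.
  (* In the degenerate case p = 0 the interval is a single point, of measure 0 = p. *)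
  case: ltP => [_|p_le0]; first by rewrite /= subr0.
  by apply/eqP; rewrite eq_le p0.
- transitivity (\int[lebesgue_measure]_(x in `]p, 1]%classic) cst v x).
    apply: eq_Rintegral => x; rewrite inE/= in_itv/= /two_step => /andP[px _].
    by rewrite leNgt px.
  rewrite Rintegral_cst//= mulrC.
  congr (_ * _); rewrite lebesgue_measure_itv/= lte_fin.
  case: ltP => //= p_ge1.
  by apply/eqP; rewrite eq_sym subr_eq0 eq_le p1 p_ge1.
Qed.

End two_step.

Theorem theorem3p3 (R : realType) (a b : R) (a_lt_b : a < b) :
  (forall (f g : R -> R) (r : R),
     step_function f -> step_function g ->
     set_fun `[0, 1] `[a, b] f -> set_fun `[0, 1] `[a, b] g ->
     r = D1 f g -> 0 < r -> r <= b - a ->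
     r <= L1 (mean_reduction f) (mean_reduction g) /\
     L1 (mean_reduction f) (mean_reduction g) <= (2 - r / (b - a)) * r) /\
  (forall r : R, 0 < r -> r <= b - a ->
     exists f0 g0 : R -> R,
       [/\ step_function f0, step_function g0,
           set_fun `[0, 1] `[a, b] f0 & set_fun `[0, 1] `[a, b] g0] /\
       D1 f0 g0 = r /\
       L1 (mean_reduction f0) (mean_reduction g0) = (2 - r / (b - a)) * r).
Proof.
split.
- move=> f g r sf sg fab gab rE r0 _.
  have fi := step_function_integrable sf.
  have gi := step_function_integrable sg.
  have [alpha] := D1_attained sf sg.
  rewrite -rE => rL rmin.
  (* Reducing both means is the single translation by [mean g - mean f], one of the competitors in
     [D1]. *)
  have LE : L1 (mean_reduction f) (mean_reduction g) =
      L1 (fun x => f x + (mean g - mean f)) g.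
    by apply: eq_mean => x _; congr `|_|; rewrite /mean_reduction; ring.
  split; first by rewrite LE rL; exact: rmin.
  have hd x : x \in `[0, 1] -> `|f x - g x| <= b - a.
    move=> x01; have /= := fab _ x01; have /= := gab _ x01.
    by rewrite !in_itv/= ler_norml; lra.
  (* The minimiser c for f - g is [- alpha]. When it lies above the mean, use g - f, whose minimiser
     is [alpha]. *)
  have [ma|am] := leP (- alpha) (mean f - mean g).
  + have L1E t : L1 (fun x => f x + t) g = mean (fun x => `|f x - g x - - t|).
      by apply: eq_mean => x _; congr `|_|; ring.
    rewrite LE L1E opprB rL L1E -meanB//.
    apply: mean_deviation_le => //; first exact: integrable01B.
    * by rewrite meanB.
    * by move=> t; rewrite -(opprK t) -!L1E.
    * by rewrite -L1E -rL.
  + have L1E t : L1 (fun x => f x + t) g = mean (fun x => `|g x - f x - t|).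
      by apply: eq_mean => x _; rewrite distrC; congr `|_|; ring.
    rewrite LE L1E rL L1E -meanB//.
    apply: mean_deviation_le => //; first exact: integrable01B.
    * by move=> x x01; rewrite distrC; exact: hd.
    * by rewrite meanB//; lra.
    * by move=> t; rewrite -!L1E.
    * by rewrite -L1E -rL.
(* The difference f0 - g0 will be b - a on [0, p] and a - b beyond. As p <= 1/2, it is optimal to
   cancel the value on the longer piece, which leaves 2 (b - a) p; this must be r. *)
- move=> r r0 rba; pose p := r / (2 * (b - a)).
  have ba0 : 0 < b - a by lra.
  have pE : 2 * (b - a) * p = r by rewrite mulrC divfK// gt_eqF// mulr_gt0.
  have p0 : 0 <= p by rewrite divr_ge0; lra.
  have ph : p <= 2^-1 by rewrite ler_pdivrMr; lra.
  have p1 : p <= 1 by lra.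
  have L1E s t : L1 (fun x => (if x <= p then b else a) + s)
      (fun x => (if x <= p then a else b) + t) =
      p * `|b + s - (a + t)| + (1 - p) * `|a + s - (b + t)|.
    rewrite -mean_two_step//.
    by apply: eq_mean => x _ /=; case: ifP.
  have L10 s : L1 (fun x => (if x <= p then b else a) + s)
      (fun x => if x <= p then a else b) =
      p * `|b + s - a| + (1 - p) * `|a + s - b|.
    rewrite -mean_two_step//.
    by apply: eq_mean => x _ /=; case: ifP.
  exists (fun x => if x <= p then b else a), (fun x => if x <= p then a else b).
  split.
    split; [exact: step_function_two_step|exact: step_function_two_step| |];
    by move=> x _ /=; rewrite in_itv/=; case: ifP => _; lra.
  split.
    apply/eqP; rewrite eq_le; apply/andP; split.
      apply: ge_inf; last first.
        exists (b - a) => //; rewrite L10.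
        rewrite (_ : a + (b - a) - b = 0); last by ring.
        by rewrite normr0 ger0_norm; [lra|lra].
      exists 0 => _ [t _ <-]; rewrite L10.
      by apply: addr_ge0; apply: mulr_ge0 => //; lra.
    apply: lb_le_inf; first by eexists; exists 0.
    move=> _ [t _ <-]; rewrite L10.
    (* Since 1 - p >= p, the cost is at least p times the sum of the two absolute values, and that
       sum is at least (b + t - a) - (a + t - b) = 2 (b - a). *)
    have h1 : b + t - a <= `|b + t - a| by exact: ler_norm.
    have h2 : - (a + t - b) <= `|a + t - b| by rewrite -normrN ler_norm.
    have h3 : 0 <= `|a + t - b| by [].
    nra.
  rewrite /mean_reduction L1E !mean_two_step//.
  (* The two pieces contribute equally, for a total of 4 (b - a) p (1 - p) = 2 r (1 - p). *)
  rewrite [X in p * `|X|](_ : _ = 2 * (b - a) * (1 - p)); last by ring.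
  rewrite [X in (1 - p) * `|X|](_ : _ = - (2 * (b - a) * p)); last by ring.
  rewrite normrN !ger0_norm; [|nra|nra].
  by rewrite /p; field; rewrite gt_eqF.
Qed.
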